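(* Let $s\ge 2$ and $k$ be integers. There exist constants $C(s,k)$ and $n_0(s,k)$, depending on $s,k$ only, such that the following holds for every integer $t\ge 1$ with $k\ge 2t+1$, every $n\ge n_0(s,k)$ and every real $\delta>0$. Let $\mathcal F\subset\binom{[n]}{k}$ be a family that does not contain a sunflower with $s$ petals and core of size exactly $t-1$, and suppose that $$|\mathcal F|\ge(1-\delta)\,\phi(s,t)\binom{n}{k-t}.$$ Then there exists a family $\mathcal T\subset\binom{[n]}{t}$ that does not contain a sunflower with $s$ petals (with any core) such that $$|\mathcal F\setminus\mathcal F[\mathcal T]|\le\Big(3k\,\phi(s,t)^2\,\delta+\frac{C(s,k)}{n}\Big)\,\phi(s,t)\binom{n-t}{k-t}.$$
   Context: $[n]=\{1,\dots,n\}$, and $\binom{X}{k}$ is the family of all $k$-element subsets of $X$. A family of $s$ (distinct) sets $\{F_1,\dots,F_s\}$ is a sunflower with $s$ petals if $F_i\cap F_j=\bigcap_{u=1}^s F_u$ for all distinct $i,j\in[s]$; the set $\bigcap_{u=1}^sF_u$ is its core. $\phi(s,t)$ denotes the maximum size of a family of $t$-element sets (on an arbitrary ground set) that does not contain a sunflower with $s$ petals (with arbitrary core). For families $\mathcal F,\mathcal B$, $\mathcal F[\mathcal B]=\{F\in\mathcal F : \exists B\in\mathcal B \text{ with } B\subset F\}$. *)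

(* Defs.v *)
From mathcomp Require Import all_boot.
From mathcomp Require Import zify.
From mathcomp Require Import boolp.
From mathcomp Require classical_sets.

Set Implicit Arguments.
Unset Strict Implicit.
Unset Printing Implicit Defensive.

Section Families.
Variable T : finType.
Implicit Types (F S B : {set {set T}}).

Definition uniform (k : nat) F : bool := [forall A in F, #|A| == k].

Definition core S : {set T} := \bigcap_(A in S) A.

Definition sunflower (s : nat) S : bool :=
  (#|S| == s) &&
  [forall A in S, forall B in S, (A != B) ==> (A :&: B == core S)].

Definition sunflower_free (s : nat) F : bool :=
  [forall S : {set {set T}}, (S \subset F) ==> ~~ sunflower s S].

Definition sunflower_core_free (s c : nat) F : bool :=
  [forall S : {set {set T}},
    (S \subset F) ==> ~~ (sunflower s S && (#|core S| == c))].

(* Usually written F[B]. *)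
Definition restr_family F B : {set {set T}} :=
  [set A in F | [exists D in B, D \subset A]].

End Families.

(* The ground set ranges over all finite types; arbitrary ground sets give the
   same maximum, since finitely many finite sets lie in a finite set. *)
Definition sunflower_free_size (s t m : nat) : Prop :=
  exists (T : finType) (F : {set {set T}}),
    [/\ uniform t F, sunflower_free s F & #|F| = m].

Definition is_max_size (s t m : nat) : Prop :=
  sunflower_free_size s t m /\
  forall m' : nat, sunflower_free_size s t m' -> m' <= m.

(* The default value 0 is only returned for s = 0, where every family contains
   the empty sunflower; see [phiP]. *)
Definition phi (s t : nat) : nat := classical_sets.xget 0 (is_max_size s t).

Lemma sunflower_freeP (T : finType) (s : nat) (F : {set {set T}}) :
  reflect (forall S : {set {set T}}, S \subset F -> ~~ sunflower s S)
    (sunflower_free s F).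
Proof.
by apply: (iffP forallP) => H S; [move=> SF; move: (H S); rewrite SF
  | apply/implyP; apply: H].
Qed.

Lemma sunflowerP (T : finType) (s : nat) (S : {set {set T}}) :
  reflect (#|S| = s /\
    forall A B, A \in S -> B \in S -> A != B -> A :&: B = core S)
  (sunflower s S).
Proof.
apply: (iffP andP) => [[/eqP cS /forall_inP H]|[cS H]]; split=> //.
- move=> A B AS BS AB; move/forall_inP: (H A AS) => /(_ B BS).
  by rewrite AB => /eqP.
- by apply/eqP.
apply/forall_inP => A AS; apply/forall_inP => B BS; apply/implyP => AB.
by apply/eqP/H.
Qed.

Lemma erdos_rado (T : finType) (s t : nat) (F : {set {set T}}) :
  0 < s -> uniform t F -> sunflower_free s F -> #|F| <= t`! * s.-1 ^ t.
Proof.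
move=> s_gt0; elim: t F => [|t IHt] F /forall_inP unifF freeF.
  rewrite fact0 expn0 muln1 -(cards1 (set0 : {set T})) subset_leq_card //.
  by apply/subsetP => A /unifF; rewrite cards_eq0 inE.
pose P (M : {set {set T}}) := (M \subset F) && trivIset M.
have P0 : P set0.
  by rewrite /P sub0set; apply/trivIsetP => A B; rewrite inE.
have [M /maxsetP [/andP [MF /trivIsetP trivM] maxM] _] := maxset_exists P0.
have ltMs : #|M| < s.
  rewrite ltnNge; apply/negP => /card_geqP [l [uniq_l size_l lM]].
  have subSM : [set A in l] \subset M.
    by apply/subsetP => A; rewrite inE; apply: lM.
  move/sunflower_freeP: freeF => /(_ _ (subset_trans subSM MF)) /negP; apply.
  apply/sunflowerP; split; first by rewrite cardsE (card_uniqP uniq_l).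
  move=> A B AS BS AB.
  have AB0 : A :&: B = set0.
    by apply/eqP; rewrite setI_eq0 trivM ?(subsetP subSM).
  apply/eqP; rewrite AB0 eq_sym -subset0 -AB0 subsetI.
  by rewrite /core !bigcap_inf.
have meetM A : A \in F -> exists2 y, y \in cover M & y \in A.
  move=> AF; have [dA|] := boolP [disjoint A & cover M]; last first.
    by case/pred0Pn => y /andP [yA yM]; exists y.
  have dAM B : B \in M -> [disjoint A & B].
    by move=> BM; apply: disjointWr dA; apply: bigcup_sup BM.
  have PAM : P (A |: M).
    rewrite /P subUset sub1set AF MF; apply/trivIsetP => B C.
    rewrite !inE => /orP [/eqP ->|BM] /orP [/eqP ->|CM] neqBC.
    - by rewrite eqxx in neqBC.
    - exact: dAM.
    - by rewrite disjoint_sym dAM.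
    - exact: trivM.
  have AM : A \in M by rewrite -(maxM _ PAM (subsetUr _ _)) setU11.
  have [y yA] : exists y, y \in A.
    by apply/card_gt0P; rewrite (eqP (unifF A AF)).
  by exists y => //; apply/bigcupP; exists A.
pose star y := [set A in F | y \in A].
have card_star y : #|star y| <= t`! * s.-1 ^ t.
  have inj_star : {in star y &, injective (fun A => A :\ y)}.
    move=> A B; rewrite !inE => /andP [_ yA] /andP [_ yB] eqAB.
    by rewrite -(setD1K yA) eqAB setD1K.
  rewrite -(card_in_imset inj_star); apply: IHt.
    apply/forall_inP => D /imsetP [A]; rewrite inE => /andP [AF yA] ->.
    by have := eqP (unifF A AF); rewrite (cardsD1 y) yA => -[/eqP].
  apply/sunflower_freeP => S /subsetP Ssub.
  apply/negP => /sunflowerP [cS interS].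
  have Sy B : B \in S -> y \notin B /\ y |: B \in F.
    move=> /Ssub /imsetP [A]; rewrite inE => /andP [AF yA] ->.
    by rewrite setD1K // !inE eqxx.
  pose S' := [set y |: B | B in S].
  have injS : {in S &, injective (fun B => y |: B)}.
    move=> B C /Sy [yB _] /Sy [yC _] eqBC.
    by rewrite -(setU1K yB) eqBC setU1K.
  have S'F : S' \subset F.
    by apply/subsetP => D /imsetP [B /Sy [_ ?] ->].
  move/sunflower_freeP: freeF => /(_ _ S'F) /negP; apply.
  apply/sunflowerP; split; first by rewrite card_in_imset.
  have coreS' : core S' = y |: core S.
    apply/setP => x; rewrite in_setU1; apply/bigcapP/idP => [xS'|].
      have [//|neqxy /=] := eqVneq x y; apply/bigcapP => B BS.
      by have := xS' _ (imset_f _ BS); rewrite in_setU1 (negPf neqxy).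
    move=> xS D /imsetP [B BS ->]; rewrite in_setU1; case: eqP xS => //= _.
    by move/bigcapP => /(_ B BS).
  move=> B' C' /imsetP [B BS ->] /imsetP [C CS ->] neqBC.
  rewrite coreS' -setUIr interS //.
  by apply: contraNneq neqBC => ->.
have coverF : F \subset \bigcup_(y in cover M) star y.
  apply/subsetP => A AF; have [y yM yA] := meetM A AF.
  by apply/bigcupP; exists y => //; rewrite inE AF.
apply: leq_trans (subset_leq_card coverF) _.
apply: leq_trans (_ : \sum_(y in cover M) #|star y| <= _).
  elim/big_rec2: _ => [|y m D _ leDm]; first by rewrite cards0.
  by apply: leq_trans (leq_card_setU _ _).1 _; rewrite leq_add2l.
apply: leq_trans (leq_sum _ (fun y _ => card_star y)) _.
rewrite sum_nat_const factS expnS.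
have card_cover : #|cover M| <= t.+1 * s.-1.
  apply: leq_trans (leq_card_cover M).1 _.
  rewrite (eq_bigr (fun=> t.+1)) => [|A /(subsetP MF) /unifF /eqP //].
  by rewrite sum_nat_const mulnC leq_mul2l; apply/orP; right; lia.
apply: leq_trans (_ : t.+1 * s.-1 * (t`! * s.-1 ^ t) <= _).
  by rewrite leq_mul2r card_cover orbT.
by rewrite mulnACA.
Qed.

Lemma phiP (s t : nat) : 0 < s -> is_max_size s t (phi s t).
Proof.
move=> s_gt0; apply: classical_sets.xgetPex.
have ex0 : exists m, `[< sunflower_free_size s t m >].
  exists 0; apply/asboolP; exists 'I_0, set0; split; last exact: cards0.
    by apply/forall_inP => A; rewrite inE.
  apply/sunflower_freeP => S; rewrite subset0 => /eqP ->.
  by apply/negP => /sunflowerP [sE _]; rewrite -sE cards0 in s_gt0.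
have ubd m : `[< sunflower_free_size s t m >] -> m <= t`! * s.-1 ^ t.
  by move=> /asboolP [T [F [unifF freeF <-]]]; apply: erdos_rado.
case: (ex_maxnP ex0 ubd) => m /asboolP sm maxm; exists m; split=> // m' sm'.
by apply: maxm; apply/asboolP.
Qed.

(* Main.v *)
(* Call a set B a kernel of F if, however few points are forbidden, some member of
   F contains B and avoids them outside B.  Sets B_1, ..., B_s that are kernels
   with common pairwise intersection extend greedily to a sunflower of F with that
   core, so F has no kernel of size t - 1.  The delta-system method (the members
   of F as words of length k, closed types of coordinates, and the theorem of
   Frankl and Katona that closed types of size t - 1 are unavoidable unless all
   supersets of some t-set are closed) gives all but O(n^(k-t-1)) members A of F
   a root: a t-set S such that all sets between S and A are kernels.

   Write A = S u G, where S is the root.  The roots attached to a (k-t)-set G, and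
   even to two (k-t)-sets meeting in at least t - 1 points, form a sunflower-free
   family, which has at most phi(s,t) members.  As F is nearly of size
   phi(s,t) C(n,k-t), almost every G is full, i.e. has phi(s,t) roots, and full
   sets that differ by one exchange have the same roots.  Two random (k-t)-sets
   are joined by a path of single exchanges through uniformly distributed sets,
   so one family of roots serves almost all G. *)
Require Import Defs.
From mathcomp Require Import all_boot all_order all_algebra.
From mathcomp Require Import reals.
From mathcomp Require boolp.
From mathcomp Require Import zify ring lra.
Import Order.TTheory GRing.Theory Num.Theory.

Set Implicit Arguments.
Unset Strict Implicit.
Unset Printing Implicit Defensive.

(** * The theorem of Frankl and Katona *)

(* Weigh the incidence [(x, p)] by [1 / deg x], which is at most [1 / deg p]. *)
Lemma card_le_of_incidence (T U : finType) (X : {set T}) (J : {set U})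
    (a : T -> U -> bool) :
  (forall x, x \in X -> exists2 p, p \in J & a x p) ->
  (forall x p, x \in X -> p \in J -> a x p ->
     #|[set y in X | a y p]| <= #|[set r in J | a x r]|) ->
  #|X| <= #|J|.
Proof.
move=> degX leap.
pose r x := #|[set p in J | a x p]|; pose b p := #|[set y in X | a y p]|.
suff: (#|X|%:R <= #|J|%:R :> rat)%R by rewrite ler_nat.
have -> : (#|X|%:R = \sum_(x in X) \sum_(p in J | a x p) (r x)%:R^-1 :> rat)%R.
  rewrite -sum1_card natr_sum; apply: eq_bigr => x xX.
  rewrite sumr_const -[RHS]mulr_natl.
  have -> : #|[pred p in J | a x p]| = r x.
    by rewrite /r; apply: eq_card => p; rewrite !inE.
  rewrite mulfV // pnatr_eq0 -lt0n; apply/card_gt0P.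
  by have [p pJ axp] := degX x xX; exists p; rewrite inE pJ.
apply: (@le_trans _ _ (\sum_(x in X) \sum_(p in J | a x p) (b p)%:R^-1)%R).
  apply: ler_sum => x xX; apply: ler_sum => p /andP [pJ axp].
  rewrite lef_pV2 ?posrE ?ltr0n ?ler_nat ?leap //; apply/card_gt0P.
    by exists p; rewrite inE pJ.
  by exists x; rewrite inE xX.
rewrite (exchange_big_dep (mem J)) => [|x p _ /andP []//] /=.
rewrite -sum1_card natr_sum; apply: ler_sum => p pJ.
rewrite sumr_const -[X in (X <= _)%R]mulr_natl.
have -> : #|[pred x | (x \in X) && ((p \in J) && a x p)]| = b p.
  by rewrite /b; apply: eq_card => x; rewrite !inE pJ.
by have [->|nz] := eqVneq (b p) 0; rewrite ?mul0r // mulfV // pnatr_eq0.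
Qed.

Lemma frankl_katona (T U : finType) (X : {set T}) (J : {set U})
    (a : T -> U -> bool) :
  (forall Y : {set T}, Y \subset X -> Y != set0 ->
     #|Y| != #|[set p in J | [forall y in Y, a y p]]|.+1) ->
  #|X| <= #|J|.
Proof.
(* If [a x p], the points [y != x] incident to [p] and the [r != p] incident to
   [x] satisfy the hypothesis again, whence [deg p <= deg x] by induction. *)
have [n] := ubnP #|J|; elim: n => // n IHn in X J *; rewrite ltnS => leJn nohit.
apply: (@card_le_of_incidence _ _ _ _ a) => [x xX|x p xX pJ axp].
  (* For a singleton the hypothesis says exactly that some [p] is incident to [x]. *)
  have := nohit [set x]; rewrite sub1set xX cards1 => /(_ isT).
  rewrite -cards_eq0 cards1 => /(_ isT); rewrite eqSS eq_sym -lt0n.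
  case/card_gt0P => p; rewrite inE => /andP [pJ /forall_inP axp].
  by exists p => //; apply: axp; rewrite inE.
rewrite (cardsD1 x) (cardsD1 p [set r in J | a x r]) !inE xX pJ axp !add1n ltnS.
have ltJn : #|[set r in J | a x r] :\ p| < n.
  apply: leq_trans leJn; rewrite [X in _ < X](cardsD1 p) pJ ltnS.
  apply: subset_leq_card; apply/subsetP => r; rewrite !inE.
  by case/and3P => -> ->.
apply: IHn ltJn _ => Y /subsetP YX Y0.
have xY : x \notin Y by apply/negP => /YX; rewrite !inE eqxx.
(* Passing from [Y] to [x |: Y] adds one point, and [p] is one more element incident to all of it,
   so the forbidden equality is preserved. *)
have := nohit (x |: Y); rewrite subUset sub1set xX cardsU1 xY add1n eqSS /=.
have -> : Y \subset X by apply/subsetP => y /YX; rewrite !inE => /and3P [].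
have -> : x |: Y != set0 by apply/set0Pn; exists x; rewrite setU11.
move=> /(_ isT isT); apply: contraNN => /eqP ->.
rewrite (cardsD1 p [set q in J | [forall y in x |: Y, a y q]]) inE pJ /=.
have -> : [forall y in x |: Y, a y p].
  apply/forall_inP => y; rewrite in_setU1 => /predU1P [-> //|/YX].
  by rewrite !inE => /and3P [].
rewrite add1n eqSS; apply/eqP/eq_card => r; rewrite !inE.
have -> : [forall y in x |: Y, a y r] = a x r && [forall y in Y, a y r].
  apply/forall_inP/andP => [H|[axr /forall_inP H] y].
    split; first by apply: H; rewrite setU11.
    by apply/forall_inP => y yY; apply: H; rewrite setU1r.
  by rewrite in_setU1 => /predU1P [-> //|/H].
by rewrite -!andbA.
Qed.

(* Add [c] points incident to everything and apply [frankl_katona]. *)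
Lemma frankl_katona_hit (T U : finType) (X : {set T}) (J : {set U})
    (a : T -> U -> bool) (c : nat) : #|J| + c < #|X| ->
  exists Y : {set T}, [/\ Y \subset X, Y != set0 &
    #|Y| = #|[set p in J | [forall y in Y, a y p]]| + c + 1].
Proof.
pose J' := [set u : U + 'I_c | if u is inl p then p \in J else true].
pose a' y (u : U + 'I_c) := if u is inl p then a y p else true.
have cardP (P : pred U) :
    #|[set u : U + 'I_c | if u is inl p then P p else true]| = #|P| + c.
  rewrite -sum1_card big_mkcond big_sumType /= -!big_mkcond /=.
  congr (_ + _).
    by rewrite -sum1_card; apply: eq_bigl => p; rewrite inE.
  by rewrite (eq_bigl predT) ?sum1_card ?card_ord // => i; rewrite inE.
move=> ltJX.
case: (boolP [exists Y : {set T}, [&& Y \subset X, Y != set0 &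
  #|Y| == #|[set p in J' | [forall y in Y, a' y p]]|.+1]]).
  case/existsP => Y /and3P [YX Y0 /eqP cY]; exists Y; split=> //; rewrite cY.
  rewrite addn1; congr _.+1.
  rewrite -cardP; apply: eq_card => -[p|i]; rewrite !inE //=.
    by rewrite -[RHS]/(p \in [set p in J | [forall y in Y, a y p]]) inE.
  by apply/forall_inP.
rewrite negb_exists => /forallP nohit; move: ltJX.
rewrite ltnNge => /negP []; rewrite -cardP.
apply: (@frankl_katona _ _ _ J' a') => Y YX Y0.
by have := nohit Y; rewrite YX Y0.
Qed.

Lemma exists_subset_card (T : finType) (A : {set T}) (n : nat) :
  n <= #|A| -> exists2 B : {set T}, B \subset A & #|B| = n.
Proof.
case/card_geqP => l [uniq_l size_l lA]; exists [set x in l].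
  by apply/subsetP => x; rewrite inE; apply: lA.
by rewrite cardsE (card_uniqP uniq_l).
Qed.

(* [I] is maximal such that no proper closed set contains its complement.  For
   [x] outside [I], some closed [A x] then omits [x] and otherwise only points of
   [I]; if some [A x0] omits a point of [I], the Frankl-Katona theorem chooses [Y]
   so that [A x0] and the [A y], [y] in [Y], meet in exactly [t - 1] points. *)
Lemma closed_supersets (V : finType) (cl : {set V} -> Prop) (t : nat) :
  0 < t -> 2 * t + 1 <= #|V| ->
  cl setT -> (forall A B, cl A -> cl B -> cl (A :&: B)) ->
  (forall A, cl A -> #|A| <> t - 1) ->
  (forall B : {set V}, #|B| = #|V| - t - 1 ->
     exists A, [/\ cl A, A <> setT & B \subset A]) ->
  exists2 I : {set V}, #|I| = t & forall A : {set V}, I \subset A -> cl A.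
Proof.
move=> t_gt0 leV clT clI ncl cover.
have clcap (I : finType) (P : pred I) (F : I -> {set V}) :
  (forall i, P i -> cl (F i)) -> cl (\bigcap_(i | P i) F i).
  by move=> clF; elim/big_rec: _ => // i A Pi clA; apply: clI => //; apply: clF.
pose indep (I : {set V}) := forall A : {set V}, cl A -> ~: I \subset A -> A = setT.
pose indepb I := boolp.asbool (indep I).
have indep0 : indepb set0.
  by apply/boolp.asboolP => A _; rewrite setC0 subTset => /eqP.
pose I := [arg max_(I > set0 | indepb I) #|I|].
have [/boolp.asboolP indI maxI] : indepb I /\ forall I', indepb I' -> #|I'| <= #|I|.
  by rewrite /I; case: arg_maxnP.
have cardCI : #|I| + #|~: I| = #|V| by rewrite cardsC.
(* A subset of [I] with [t + 1] points has a complement of size [#|V| - t - 1], which lies in a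
   proper closed set. *)
have leIt : #|I| <= t.
  rewrite leqNgt; apply/negP => ltI.
  have [I0 sub0 card0] := exists_subset_card ltI.
  have [|A [clA nA subA]] := cover (~: I0).
    by have := cardsC I0; rewrite card0; lia.
  apply: nA; apply: indI => //; apply: subset_trans subA; by rewrite setCS.
have exA x : exists A : {set V},
    x \notin I -> [/\ cl A, x \notin A & ~: (x |: I) \subset A].
  have [xI|xI] := boolP (x \in I); first by exists set0.
  have : ~ indep (x |: I).
    move=> ind; have := maxI (x |: I); rewrite /indepb.
    move=> /(_ (introT (boolp.asboolP _) ind)).
    by rewrite cardsU1 xI ltnn.
  move=> /boolp.existsNP [A /boolp.not_implyP [clA /boolp.not_implyP [subA nA]]].
  exists A => _; split=> //; apply/negP => xA; apply: nA; apply: indI => //.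
  apply/subsetP => y yI; have [->//|nyx] := eqVneq y x.
  by apply: (subsetP subA); move: yI; rewrite !inE (negPf nyx).
have [A HA] := boolp.choice exA.
have [/existsP [x0 /andP [x0I nA0]]|/existsPn allA] :=
    boolP [exists x, (x \notin I) && ~~ (I \subset A x)].
  have [clA0 xA0 subA0] := HA _ x0I; exfalso.
  have ltI0 : #|I :&: A x0| < #|I|.
    apply: proper_card; rewrite properEneq subsetIl andbT.
    by apply: contraNneq nA0 => /setIidPl.
  have cX : #|~: I| = (#|~: I :\ x0|).+1 by rewrite (cardsD1 x0) inE x0I.
  (* Write [c] for the last argument. The intersection [B] below has [#|Y| - c - 1] points in [I]
     and [#|~: I :\ x0| - #|Y|] points outside. The sum is independent of [Y], and this [c] makes it
     [t - 1]. *)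
  have [|Y [YX Y0 cY]] := @frankl_katona_hit _ _ (~: I :\ x0) (I :&: A x0)
    (fun y p => p \in A y) (#|V| - t - 1 - #|I|).
    by lia.
  have YP y : y \in Y -> y \notin I /\ y != x0.
    by move/(subsetP YX); rewrite !inE => /andP [].
  pose B := A x0 :&: \bigcap_(y in Y) A y.
  have clB : cl B by apply: clI => //; apply: clcap => y /YP [yI _]; case: (HA _ yI).
  apply: (ncl _ clB).
  rewrite -(cardsID I B).
  have -> : B :&: I = [set p in I :&: A x0 | [forall y in Y, p \in A y]].
    apply/setP => p; rewrite !inE [LHS]andbC andbA; congr (_ && _).
    by apply/bigcapP/forall_inP.
  have -> : B :\: I = (~: I :\ x0) :\: Y.
    apply/setP => p; rewrite !inE; case pI: (p \in I) => /=; first by rewrite !andbF.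
    have pcov x : x \notin I -> p != x -> p \in A x.
      move=> xI px; have [_ _ /subsetP] := HA _ xI; apply.
      by rewrite !inE (negPf px) pI.
    apply/andP/and3P => [[pA0 /bigcapP pA]|[pY px0 _]].
      split=> //; last by apply: contraNneq xA0 => px; rewrite -{1}px.
      apply/negP => pY; have [yI _] := YP _ pY; have [_ /negP] := HA _ yI.
      by case; apply: pA.
    split; first exact: pcov.
    apply/bigcapP => y yY; have [yI _] := YP _ yY; apply: pcov => //.
    by apply: contraNneq pY => ->.
  rewrite cardsD; have /setIidPr -> : Y \subset ~: I :\ x0 by [].
  have leY : #|Y| <= #|~: I :\ x0| by apply: subset_leq_card.
  by lia.
(* In the remaining case [A x] omits [x] alone, and every superset of [I] is an intersection of such
   sets. *)
have clC1 x : x \notin I -> cl (~: [set x]).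
  move=> xI; have [clA xA /subsetP subA] := HA _ xI.
  have -> // : ~: [set x] = A x; apply/setP => y; rewrite !inE.
  have [-> | yx] := eqVneq y x; first by rewrite (negPf xA).
  have := allA x; rewrite xI /= negbK => /subsetP IA; apply/esym.
  have [yI|yI] := boolP (y \in I); first exact: IA.
  by apply: subA; rewrite !inE (negPf yx).
have clsup (B : {set V}) : I \subset B -> cl B.
  move=> /subsetP IB; have -> : B = \bigcap_(x in ~: B) ~: [set x].
    apply/setP => y; apply/idP/bigcapP => [yB x|H].
      by rewrite !inE => xB; apply: contraNneq xB => <-.
    by apply/negPn/negP => yB; have := H y; rewrite !inE eqxx yB => /(_ isT).
  by apply: clcap => x; rewrite inE => xB; apply: clC1; apply: contraNN xB => /IB.
exists I => //; apply/eqP; rewrite eqn_leq leIt leqNgt; apply/negP => ltIt.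
(* If [#|I| < t], some superset of [I] has exactly [t - 1] points; [Z] is its complement. *)
have [|Z ZI cZ] := @exists_subset_card _ (~: I) (#|V| - t + 1); first by lia.
apply: (ncl (~: Z)).
  by apply: clsup; rewrite -(setCK I) setCS.
by have := cardsC Z; rewrite cZ; lia.
Qed.

(** * Kernels and sunflowers *)

Definition kernel (T : finType) (q : nat) (F : {set {set T}}) (B : {set T}) :=
  [forall X : {set T}, (#|X| <= q) ==>
     [exists A in F, (B \subset A) && (A :&: X \subset B)]].

Lemma kernelP (T : finType) (q : nat) (F : {set {set T}}) (B : {set T}) :
  reflect (forall X : {set T}, #|X| <= q ->
             exists A, [/\ A \in F, B \subset A & A :&: X \subset B])
          (kernel q F B).
Proof.
apply: (iffP forallP) => [H X leX|H X].
  by have := H X; rewrite leX => /existsP [A /and3P []]; exists A.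
by apply/implyP => /H [A [AF BA AX]]; apply/existsP; exists A; rewrite AF BA.
Qed.

Lemma card_bigcup_leq (I T : finType) (P : pred I) (A : I -> {set T}) (c : nat) :
  (forall i, P i -> #|A i| <= c) -> #|\bigcup_(i | P i) A i| <= #|P| * c.
Proof.
move=> leA; rewrite -sum_nat_const.
apply: (@leq_trans (\sum_(i | P i) #|A i|)); last exact: leq_sum.
elim/big_rec2: _ => [|i m B _ leBm]; first by rewrite cards0.
by apply: leq_trans (leq_card_setU _ _).1 _; rewrite leq_add2l.
Qed.

(** Members of [F] are picked one at a time, the one above [B i] avoiding all [B j] and the earlier
    members outside [B i]. The [B i] may coincide: [#|C| < k] still makes the chosen members
    distinct. *)
Lemma kernel_sunflower (T : finType) (s k : nat) (F : {set {set T}})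
    (B : 'I_s -> {set T}) (C : {set T}) :
  1 < s -> uniform k F -> (forall i, kernel (2 * s * k) F (B i)) ->
  (forall i j, i != j -> B i :&: B j = C) -> #|C| < k ->
  ~~ sunflower_core_free s #|C| F.
Proof.
move=> s_gt1 /forall_inP unifF kerB capB ltC.
have sizeB i : #|B i| <= k.
  have /kernelP /(_ set0) := kerB i; rewrite cards0 => /(_ isT) [A [AF BA _]].
  by rewrite -(eqP (unifF _ AF)); apply: subset_leq_card.
have [A HA] : exists A : 'I_s -> {set T}, forall i, [/\ A i \in F, B i \subset A i,
    forall j, A i :&: B j \subset B i &
    forall j : 'I_s, j < i -> A i :&: A j \subset B i].
  have part m : m <= s -> exists A : 'I_s -> {set T}, forall i : 'I_s, i < m ->
      [/\ A i \in F, B i \subset A i, forall j, A i :&: B j \subset B i &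
      forall j : 'I_s, j < i -> A i :&: A j \subset B i].
    elim: m => [|m IHm] ltms; first by exists B.
    have [A HA] := IHm (ltnW ltms); pose im := Ordinal ltms.
    (* Forbidden are [s] sets [B j] and fewer than [s] earlier members, each of at most [k] points;
       hence the threshold [2 * s * k]. *)
    pose X := \bigcup_j B j :|: \bigcup_(j : 'I_s | j < m) A j.
    have leX : #|X| <= 2 * s * k.
      apply: leq_trans (leq_card_setU _ _).1 _.
      rewrite -mulnA mul2n -addnn leq_add //.
        by rewrite -[X in _ <= X * _](card_ord s); apply: card_bigcup_leq.
      apply: leq_trans (card_bigcup_leq (c := k) _) _.
        by move=> j /HA [AF _ _ _]; rewrite (eqP (unifF _ AF)).
      by rewrite leq_mul2r -[X in _ <= X](card_ord s) max_card orbT.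
    have /kernelP /(_ X leX) [D [DF BD DX]] := kerB im.
    exists (fun i => if i == im then D else A i) => i; rewrite ltnS leq_eqVlt.
    have subD (E : {set T}) : E \subset X -> D :&: E \subset B im.
      by move=> EX; apply: subset_trans DX; apply: setIS.
    have subBX j : B j \subset X.
      by apply: subset_trans (subsetUl _ _); apply: (bigcup_sup j).
    have subAX (j : 'I_s) : j < m -> A j \subset X.
      by move=> jm; apply: subset_trans (subsetUr _ _); apply: (bigcup_sup j).
    case: (eqVneq i im) => [-> _|nim].
      split=> // [j|j ltj]; first exact: subD.
      rewrite -val_eqE /= ltn_eqF //; exact/subD/subAX.
    rewrite -(inj_eq val_inj) /= in nim; rewrite (negPf nim) /= => lti.
    have [AF BA AB AA] := HA i lti; split=> // j ltj.
    by rewrite -val_eqE /= ltn_eqF ?(ltn_trans ltj) //; apply: AA.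
  by have [A HA] := part s (leqnn s); exists A => i; apply: HA.
have capA (i j : 'I_s) : i != j -> A i :&: A j = C.
  (* The later set [A i'] meets [A j'] inside [B i'] only, and [A j'] meets [B i'] inside [B j']
     only. *)
  have ltcap (i' j' : 'I_s) : j' < i' -> A i' :&: A j' = C.
    move=> ltji; rewrite -(capB i' j'); last by rewrite neq_ltn ltji orbT.
    have [_ BAi ABi AAi] := HA i'; have [_ BAj ABj _] := HA j'.
    apply/eqP; rewrite eqEsubset (setISS BAi BAj) andbT subsetI AAi //=.
    apply: subset_trans (ABj i').
    by rewrite subsetI subsetIr AAi.
  by rewrite neq_ltn => /orP [/ltcap|/ltcap //]; rewrite setIC.
have injA : injective A.
  move=> i j eqA; apply/eqP/negPn/negP => nij.
  have := capA i j nij; rewrite eqA setIid => eqC.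
  by have [AF _ _ _] := HA j; move: ltC; rewrite -eqC (eqP (unifF _ AF)) ltnn.
rewrite /sunflower_core_free negb_forall; apply/existsP; exists (A @: setT).
have coreC : core (A @: setT) = C.
  pose i0 := Ordinal (ltnW s_gt1); pose i1 := Ordinal s_gt1.
  apply/eqP; rewrite eqEsubset; apply/andP; split.
    by rewrite -(capA i0 i1) // subsetI /core !bigcap_inf // imset_f ?inE.
  apply/bigcapsP => D /imsetP [i _ ->].
  have [j nij] : exists j, i != j.
    by case: (eqVneq i i0) => [->|]; [exists i1 | exists i0].
  by rewrite -(capA i j nij) subsetIl.
rewrite negb_imply negbK coreC eqxx andbT; apply/andP; split.
  by apply/subsetP => D /imsetP [i _ ->]; case: (HA i).
apply/sunflowerP; split; first by rewrite card_imset // cardsT card_ord.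
move=> D E /imsetP [i _ ->] /imsetP [j _ ->] nij; rewrite coreC capA //.
by apply: contraNneq nij => ->.
Qed.

(** * Homogeneous subfamilies *)

Section Dependencies.
Variables (T : finType) (k : nat).
Implicit Types (R : {set {ffun 'I_k -> T}}) (J : {set 'I_k}).

(* The coordinates in [J] determine no further coordinate on [R]. *)
Definition dep_closed R J : bool :=
  [forall c, (c \notin J) ==>
     [exists f in R, exists g in R, [forall i in J, f i == g i] && (f c != g c)]].

Lemma dep_closedP R J :
  reflect (forall c, c \notin J -> exists f g,
             [/\ f \in R, g \in R, {in J, f =1 g} & f c != g c])
          (dep_closed R J).
Proof.
apply: (iffP forallP) => [H c cJ|H c].
  have := H c; rewrite cJ /= => /exists_inP [f fR /exists_inP [g gR]].
  case/andP => /forall_inP fg nfg; exists f, g; split=> // i /fg /eqP //.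
apply/implyP => /H [f [g [fR gR fg nfg]]].
apply/exists_inP; exists f => //; apply/exists_inP; exists g => //.
by rewrite nfg andbT; apply/forall_inP => i /fg ->.
Qed.

Lemma dep_closedT R : dep_closed R setT.
Proof. by apply/dep_closedP => c; rewrite inE. Qed.

Lemma dep_closedI R J1 J2 :
  dep_closed R J1 -> dep_closed R J2 -> dep_closed R (J1 :&: J2).
Proof.
move=> /dep_closedP cl1 /dep_closedP cl2; apply/dep_closedP => c.
rewrite inE negb_and => /orP [/cl1|/cl2] [f [g [fR gR fg nfg]]];
  by exists f, g; split=> // i; rewrite inE => /andP [i1 i2]; apply: fg.
Qed.

Lemma dep_closedS R R' J : R' \subset R -> dep_closed R' J -> dep_closed R J.
Proof.
move=> /subsetP R'R /dep_closedP cl; apply/dep_closedP => c /cl.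
by case=> f [g [fR gR fg nfg]]; exists f, g; split=> //; apply: R'R.
Qed.

(** The coordinates on which two members of [R] agree form a closed set. Hence members that agree on
    [B] are equal, and restriction to [B] is injective on [R]. *)
Lemma card_dep_spanning R (B : {set 'I_k}) :
  (forall J : {set 'I_k}, dep_closed R J -> B \subset J -> J = setT) ->
  #|R| <= #|T| ^ #|B|.
Proof.
move=> spanB.
pose res (f : {ffun 'I_k -> T}) : {ffun {i | i \in B} -> T} := [ffun i => f (val i)].
have inj_res : {in R &, injective res}.
  move=> f g fR gR eq_res; pose J := [set i | f i == g i].
  have JT : J = setT.
    apply: spanB; last first.
      apply/subsetP => i iB; rewrite inE.
      have := congr1 (fun h : {ffun _ -> _} => h (exist _ i iB)) eq_res.
      by rewrite !ffunE /= => ->.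
    apply/dep_closedP => c; rewrite inE => nfg; exists f, g; split=> //.
    by move=> i; rewrite inE => /eqP.
  by apply/ffunP => i; apply/eqP; have := in_setT i; rewrite -JT inE.
rewrite -(card_in_imset inj_res); apply: leq_trans (max_card _) _.
by rewrite card_ffun card_sig.
Qed.

End Dependencies.

(* [Rs] maximizes [#|R| * W ^ (number of non-closed types)]: restricting to the
   functions bad for a closed type and refining by a label determining one more
   coordinate would increase this potential unless few functions are bad. *)
Lemma homogeneous_subfamily (T : finType) (k q : nat) (F : {set {set T}})
    (R : {set {ffun 'I_k -> T}}) :
  R != set0 -> (forall f : {ffun 'I_k -> T}, f \in R -> f @: setT \in F) ->
  exists2 Rs : {set {ffun 'I_k -> T}}, Rs \subset R &
    #|R| <= #|Rs| * (2 ^ k * (k * q) + 1) ^ (2 ^ k) /\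
    exists2 f : {ffun 'I_k -> T}, f \in Rs &
      forall J : {set 'I_k}, dep_closed Rs J -> kernel q F (f @: J).
Proof.
move=> R0 RF; pose W := 2 ^ k * (k * q) + 1.
pose nc (R : {set {ffun 'I_k -> T}}) := #|[set J | ~~ dep_closed R J]|.
have ncS (R1 R2 : {set {ffun 'I_k -> T}}) : R1 \subset R2 -> nc R2 <= nc R1.
  move=> R12; apply: subset_leq_card; apply/subsetP => J; rewrite !inE.
  by apply: contraNN; apply: dep_closedS.
have W_gt0 : 0 < W by rewrite /W addn1.
have ex_Rs : exists Rs : {set {ffun 'I_k -> T}}, Rs \subset R /\
    forall R' : {set {ffun 'I_k -> T}},
    R' \subset R -> #|R'| * W ^ nc R' <= #|Rs| * W ^ nc Rs.
  have RR : R \subset R by [].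
  exists [arg max_(R' > R | R' \subset R) (#|R'| * W ^ nc R')].
  by case: arg_maxnP.
have {ex_Rs} [Rs [RsR maxRs]] := ex_Rs.
have leR : #|R| <= #|Rs| * W ^ (2 ^ k).
  apply: leq_trans (leq_trans (maxRs R _) _) => //.
    by rewrite -[X in X <= _]muln1 leq_mul2l expn_gt0 W_gt0 orbT.
  rewrite leq_mul2l leq_pexp2l ?orbT //.
  apply: leq_trans (max_card _) _; rewrite -cardsT -powersetT card_powerset.
  by rewrite cardsT card_ord.
exists Rs => //; split=> //.
have Rs_gt0 : 0 < #|Rs|.
  rewrite lt0n; apply: contraNneq R0 => Rs0.
  by rewrite -cards_eq0 -leqn0 (leq_trans leR) // Rs0.
pose bad (J : {set 'I_k}) := [set f in Rs | ~~ kernel q F (f @: J)].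
have leW a b c : a <= b * (c %/ W) -> a * W <= b * c.
  move=> leab; apply: leq_trans (leq_mul leab (leqnn W)) _.
  by rewrite -mulnA leq_mul2l leq_trunc_div orbT.
have leBad J : dep_closed Rs J -> #|bad J| * W <= k * q * #|Rs|.
  move=> clJ.
  have exX (D : {set T}) : exists X : {set T}, ~~ kernel q F D -> #|X| <= q /\
      forall A : {set T}, A \in F -> D \subset A -> ~~ (A :&: X \subset D).
    have [kD|] := boolP (kernel q F D); first by exists set0.
    rewrite negb_forall => /existsP [X]; rewrite negb_imply => /andP [leX].
    rewrite negb_exists => /forallP nA; exists X => _; split=> // A AF DA.
    by have := nA A; rewrite AF DA.
  have [X HX] := boolp.choice exX.
  (* If [f] is bad for [J], the blocking set [X (f @: J)] contains some [f c] with [c] outside [J].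
     The label records [c] and the position of [f c] in that set. *)
  pose lab (p : 'I_k * 'I_q) := [set f in bad J | (f p.1 \in X (f @: J)) &&
     (index (f p.1) (enum (X (f @: J))) == p.2)].
  apply: leW.
  apply: (@leq_trans #|\bigcup_(p | p.1 \notin J) lab p|).
    apply: subset_leq_card; apply/subsetP => f fbad.
    have := fbad; rewrite inE => /andP [fRs nker].
    have [leX /(_ (f @: setT))] := HX _ nker.
    rewrite RF ?(subsetP RsR) // imsetS ?subsetT // => /(_ isT isT).
    case/subsetPn => x; rewrite inE => /andP [/imsetP [c _ ->] fcX] fcJ.
    have ltq : index (f c) (enum (X (f @: J))) < q.
      by apply: leq_trans leX; rewrite cardE index_mem mem_enum.
    apply/bigcupP; exists (c, Ordinal ltq).
      by rewrite /=; apply: contraNN fcJ => cJ; apply: imset_f.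
    by rewrite in_set /= fbad fcX eqxx.
  apply: leq_trans (card_bigcup_leq (c := #|Rs| %/ W) _) _ => [p pJ|]; last first.
    by rewrite leq_mul2r (leq_trans (max_card _)) ?orbT // card_prod !card_ord.
  have labRs : lab p \subset Rs.
    by apply/subsetP => f; rewrite !inE => /andP [/andP []].
  (* On [lab p] the coordinates in [J] determine the coordinate [p.1], so [J] stops being closed
     while no type becomes closed. The exponent [nc] grows, and maximality of [Rs] gives
     [#|lab p| * W <= #|Rs|]. *)
  rewrite leq_divRL // -(leq_pmul2r (_ : 0 < W ^ nc Rs)) ?expn_gt0 ?W_gt0 //.
  apply: leq_trans (maxRs _ (subset_trans labRs RsR)).
  rewrite -mulnA -expnS leq_mul2l leq_pexp2l ?orbT //.
  apply: proper_card; rewrite properE; apply/andP; split.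
    by apply/subsetP => K; rewrite !inE; apply: contraNN; apply: dep_closedS.
  apply/subsetPn; exists J; rewrite inE ?negbK //.
  apply/negP => /dep_closedP /(_ _ pJ) [f [g [flab glab fg]]] /eqP; apply.
  have eqJ : f @: J = g @: J by apply: eq_in_imset.
  move: flab glab; rewrite !inE eqJ => /and3P [_ fX /eqP fi] /and3P [_ gX /eqP gi].
  rewrite -[f _](nth_index (f p.1) (s := enum (X (g @: J)))) ?mem_enum // fi -gi.
  by rewrite nth_index ?mem_enum.
case: (boolP [exists f in Rs, [forall J, dep_closed Rs J ==> kernel q F (f @: J)]]).
  by case/exists_inP => f fRs /forallP H; exists f => // J; apply/implyP.
rewrite negb_exists => /forallP nex; exfalso.
(* Each member would be bad for one of at most [2 ^ k] closed types, which forces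
   [W <= 2 ^ k * (k * q)]. *)
have : #|Rs| <= 2 ^ k * ((k * q * #|Rs|) %/ W).
  apply: (@leq_trans #|\bigcup_(J | dep_closed Rs J) bad J|).
    apply: subset_leq_card; apply/subsetP => f fRs.
    have := nex f; rewrite fRs /= negb_forall => /existsP [J].
    rewrite negb_imply => /andP [clJ nker].
    by apply/bigcupP; exists J => //; rewrite inE fRs.
  apply: leq_trans (card_bigcup_leq (c := (k * q * #|Rs|) %/ W) _) _.
    by move=> J clJ; rewrite leq_divRL // leBad.
  rewrite leq_mul2r (leq_trans (max_card _)) ?orbT //.
  by rewrite -cardsT -powersetT card_powerset cardsT card_ord.
by move/leW; rewrite mulnA mulnC leq_pmul2r // /W addn1 ltnn.
Qed.

Definition is_root (T : finType) (q : nat) (F : {set {set T}}) (A S : {set T}) :=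
  (S \subset A) && [forall E : {set T}, (S \subset E) && (E \subset A) ==> kernel q F E].

Definition rootless (T : finType) (q t : nat) (F : {set {set T}}) :=
  [set A in F | ~~ [exists S : {set T}, (#|S| == t) && is_root q F A S]].

(** Apply [homogeneous_subfamily] to all enumerations of rootless members. If some [k - t - 1]
    coordinates span [Rs], [card_dep_spanning] gives the bound. Otherwise [closed_supersets] yields
    a set [I] of coordinates whose image is a root of a rootless member. *)
Lemma card_rootless (T : finType) (k t q : nat) (F : {set {set T}}) :
  uniform k F -> 0 < t -> 2 * t + 1 <= k ->
  (forall B : {set T}, #|B| = t - 1 -> ~~ kernel q F B) ->
  #|rootless q t F| <= (2 ^ k * (k * q) + 1) ^ (2 ^ k) * #|T| ^ (k - t - 1).
Proof.
move=> /forall_inP unifF t_gt0 lek nker.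
pose R := [set f : {ffun 'I_k -> T} | f @: setT \in rootless q t F].
have leR : #|rootless q t F| <= #|R|.
  apply: leq_trans (leq_imset_card (fun f : {ffun 'I_k -> T} => f @: setT) (mem R)).
  apply: subset_leq_card; apply/subsetP => A AR.
  have /eqP cA : #|A| == k by apply: unifF; move: AR; rewrite inE => /andP [].
  pose f : {ffun 'I_k -> T} := [ffun i => enum_val (cast_ord (esym cA) i)].
  have fA : f @: setT = A.
    apply/setP => x; apply/imsetP/idP => [[i _ ->]|xA].
      by rewrite ffunE enum_valP.
    exists (cast_ord cA (enum_rank_in xA x)) => //.
    by rewrite ffunE cast_ordK enum_rankK_in.
  by apply/imsetP; exists f => //; rewrite in_set fA.
have [R0|R0] := eqVneq R set0; first by rewrite (leq_trans leR) // R0 cards0.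
have RF (f : {ffun 'I_k -> T}) : f \in R -> f @: setT \in F.
  by rewrite inE [_ \in rootless _ _ _]inE => /andP [].
have [Rs RsR [leRs [f fRs kerf]]] := homogeneous_subfamily q R0 RF.
apply: leq_trans leR (leq_trans leRs _); rewrite mulnC leq_mul2l; apply/orP; right.
have fR := subsetP RsR _ fRs.
have injf : injective f.
  have injT : {in setT &, injective f}.
    by apply/imset_injP; rewrite (eqP (unifF _ (RF _ fR))) cardsT card_ord.
  by move=> i j; apply: injT; rewrite inE.
have injfs : injective (fun J : {set 'I_k} => f @: J) by apply: imset_inj.
case: (boolP [exists B : {set 'I_k}, (#|B| == k - t - 1) &&
    [forall J : {set 'I_k}, dep_closed Rs J && (B \subset J) ==> (J == setT)]]).
  case/existsP => B /andP [/eqP <- /forallP spanB]; apply: card_dep_spanning.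
  by move=> J clJ BJ; have := spanB J; rewrite clJ BJ => /eqP.
move/existsPn => nspan; exfalso.
have [||||B cB|I cI clI] := @closed_supersets 'I_k (dep_closed Rs) t t_gt0.
- by rewrite card_ord.
- exact: dep_closedT.
- by move=> J1 J2; apply: dep_closedI.
- move=> J clJ cJ; have /negP nk : ~~ kernel q F (f @: J).
    by apply: nker; rewrite card_imset.
  exact/nk/kerf.
- have := nspan B; rewrite cB card_ord eqxx /= negb_forall => /existsP [J].
  by rewrite negb_imply => /andP [/andP [clJ BJ] /eqP nJ]; exists J.
move: fR; rewrite inE [_ \in rootless _ _ _]inE => /andP [_ /existsPn /(_ (f @: I))].
rewrite card_imset // cI eqxx /= => /negP; apply; apply/andP; split.
  by rewrite imsetS ?subsetT.
apply/forallP => E; apply/implyP => /andP [IE EA].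
have -> : E = f @: (f @^-1: E).
  apply/setP => x; apply/idP/imsetP => [xE|[i]]; last by rewrite inE => ? ->.
  by have /imsetP [i _ xi] := subsetP EA _ xE; exists i => //; rewrite inE -xi.
by apply/kerf/clI; rewrite -sub_imset_pre.
Qed.

(** * Roots *)

Definition roots (T : finType) (q t : nat) (F : {set {set T}}) (G : {set T}) :=
  [set S : {set T} | [&& #|S| == t, [disjoint S & G], S :|: G \in F
                       & is_root q F (S :|: G) S]].

Lemma roots_uniform (T : finType) (q t : nat) (F : {set {set T}}) (G : {set T}) :
  uniform t (roots q t F G).
Proof. by apply/forall_inP => S; rewrite inE => /and4P []. Qed.

Lemma roots_kernel (T : finType) (q t : nat) (F : {set {set T}}) (G E S : {set T}) :
  S \in roots q t F G -> E \subset G -> kernel q F (S :|: E).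
Proof.
rewrite inE => /and4P [_ _ _ /andP [_ /forallP H]] EG.
by have := H (S :|: E); rewrite subsetUl setUS.
Qed.

Lemma sunflower_core_card (T : finType) (s t : nat) (S : {set {set T}}) :
  1 < s -> uniform t S -> sunflower s S -> #|core S| < t.
Proof.
move=> s_gt1 /forall_inP unifS /sunflowerP [cS capS].
have [A [B [AS BS nAB]]] : exists A B, [/\ A \in S, B \in S & A != B].
  by apply/card_gt1P; rewrite cS.
rewrite -(capS A B) // ltnNge -{1}(eqP (unifS _ AS)); apply: contraNN nAB => leA.
have /eqP eqA : A :&: B == A by rewrite eqEcard subsetIl.
rewrite eqEcard (eqP (unifS _ AS)) (eqP (unifS _ BS)) leqnn andbT.
exact/setIidPl.
Qed.

(** A sunflower of roots has a core of fewer than [t] points. Adding points of [G :&: G'], which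
    miss all its petals, raises the core to exactly [t - 1] points and leaves the petals kernels,
    against [kernel_sunflower]. *)
Lemma sunflower_free_roots (T : finType) (s k t : nat) (F : {set {set T}})
    (G G' : {set T}) :
  1 < s -> 0 < t -> t <= k -> uniform k F -> sunflower_core_free s (t - 1) F ->
  t - 1 <= #|G :&: G'| ->
  sunflower_free s (roots (2 * s * k) t F G :|: roots (2 * s * k) t F G').
Proof.
set q := 2 * s * k => s_gt1 t_gt0 lek unifF freeF leG.
apply/sunflower_freeP => S /subsetP SG; apply/negP => sunS.
have rootS B : B \in S -> [/\ #|B| = t, [disjoint B & G :&: G'] &
    forall E : {set T}, E \subset G :&: G' -> kernel q F (B :|: E)].
  move/SG; rewrite inE => /orP [] BG; have := BG; rewrite inE => /and4P [/eqP cB dB _ _].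
    split=> // [|E EG]; first exact: disjointWr (subsetIl _ _) dB.
    exact: roots_kernel BG (subset_trans EG (subsetIl _ _)).
  split=> // [|E EG]; first exact: disjointWr (subsetIr _ _) dB.
  exact: roots_kernel BG (subset_trans EG (subsetIr _ _)).
have ltD : #|core S| < t.
  apply: (@sunflower_core_card _ s) => //.
  by apply/forall_inP => B /rootS [->].
have /sunflowerP [cS capS] := sunS.
have [|E EG cE] := @exists_subset_card _ (G :&: G') (t - 1 - #|core S|); first by lia.
have cC : #|core S :|: E| = t - 1.
  rewrite cardsU; have -> : core S :&: E = set0.
    have /card_gt0P [B BS] : 0 < #|S| by rewrite cS ltnW.
    have [_ dB _] := rootS B BS.
    have /eqP dB0 : B :&: (G :&: G') == set0 by rewrite setI_eq0.
    by apply/eqP; rewrite -subset0 -dB0 setISS // bigcap_inf.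
  by rewrite cards0 cE; lia.
pose B (i : 'I_s) := enum_val (cast_ord (esym cS) i).
have BS i : B i \in S by apply: enum_valP.
have injB : injective B.
  by move=> i j /enum_val_inj /cast_ord_inj.
have kerB i : kernel q F (B i :|: E) by have [_ _] := rootS _ (BS i); apply.
have capB i j : i != j -> (B i :|: E) :&: (B j :|: E) = core S :|: E.
  by move=> nij; rewrite -setUIl capS // (inj_eq injB).
have ltC : #|core S :|: E| < k by lia.
by have := kernel_sunflower s_gt1 unifF kerB capB ltC; rewrite cC freeF.
Qed.

Lemma sunflower_free_phi (T : finType) (s t : nat) (F : {set {set T}}) :
  0 < s -> uniform t F -> sunflower_free s F -> #|F| <= phi s t.
Proof. by move=> s_gt0 unifF freeF; apply: (phiP t s_gt0).2; exists T, F. Qed.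

Lemma phi_gt0 (s t : nat) : 1 < s -> 0 < phi s t.
Proof.
move=> s_gt1; have <- := cards1 [set: 'I_t]; apply: sunflower_free_phi.
- exact: ltnW.
- by apply/forall_inP => A; rewrite inE => /eqP ->; rewrite cardsT card_ord.
apply/sunflower_freeP => S /subset_leq_card; rewrite cards1 => leS.
by apply/negP => /sunflowerP [cS _]; move: leS; rewrite cS leqNgt s_gt1.
Qed.

Section Roots.
Variables (T : finType) (s k t : nat) (F : {set {set T}}).
Hypotheses (s_gt1 : 1 < s) (t_gt0 : 0 < t) (lek : 2 * t + 1 <= k).
Hypotheses (unifF : uniform k F) (freeF : sunflower_core_free s (t - 1) F).
Let q := 2 * s * k.

Lemma card_rootsU (G G' : {set T}) :
  t - 1 <= #|G :&: G'| -> #|roots q t F G :|: roots q t F G'| <= phi s t.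
Proof.
move=> leG; apply: sunflower_free_phi; first exact: ltnW.
  apply/forall_inP => A; rewrite inE => /orP [] AG.
    by have /forall_inP := roots_uniform q t F G; apply.
  by have /forall_inP := roots_uniform q t F G'; apply.
by apply: sunflower_free_roots => //; lia.
Qed.

Lemma card_roots (G : {set T}) : #|G| = k - t -> #|roots q t F G| <= phi s t.
Proof.
by move=> cG; have := @card_rootsU G G; rewrite setUid setIid; apply; lia.
Qed.

(** The union of the two families has at most [phi s t] members, so each of them is the whole
    union. *)
Lemma eq_full_roots (G G' : {set T}) : t - 1 <= #|G :&: G'| ->
  #|roots q t F G| = phi s t -> #|roots q t F G'| = phi s t ->
  roots q t F G = roots q t F G'.
Proof.
move=> leG cG cG'; have leU := card_rootsU leG.
transitivity (roots q t F G :|: roots q t F G').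
  by apply/eqP; rewrite eqEcard subsetUl cG.
by apply/esym/eqP; rewrite eqEcard subsetUr cG'.
Qed.

Lemma card_by_roots (AA GG : {set {set T}}) :
  (forall A, A \in AA -> exists S G,
     [/\ A = S :|: G, G \in GG & S \in roots q t F G]) ->
  #|AA| <= \sum_(G in GG) #|roots q t F G|.
Proof.
move=> HA.
apply: (@leq_trans #|\bigcup_(G in GG) [set S :|: G | S in roots q t F G]|).
  apply: subset_leq_card; apply/subsetP => A /HA [S [G [-> GGG SG]]].
  by apply/bigcupP; exists G => //; apply: imset_f.
elim/big_rec2: _ => [|G m B _ leBm]; first by rewrite cards0.
apply: leq_trans (leq_card_setU _ _).1 _; rewrite leq_add //.
exact: leq_imset_card.
Qed.

Lemma rooted_split (A : {set T}) : A \in F -> A \notin rootless q t F ->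
  exists S G, [/\ A = S :|: G, #|G| = k - t & S \in roots q t F G].
Proof.
move=> AF; rewrite inE AF /= negbK => /existsP [S /andP [/eqP cS rS]].
have /andP [SA _] := rS; have eA : S :|: A :\: S = A by rewrite -{1}(setIidPr SA) setID.
exists S, (A :\: S); rewrite eA; split=> //.
  by move/forall_inP: unifF => /(_ A AF) /eqP <-; rewrite cardsD (setIidPr SA) cS.
by rewrite inE cS eqxx eA AF rS /= andbT disjoint_sym disjoints_subset subsetDr.
Qed.

Let slices := [set G : {set T} | #|G| == k - t].

(** Rooted members are counted by the slice left when a root is removed. A slice that is not full
    falls short of [phi s t] by at least one. *)
Lemma card_nonfull :
  #|F| + #|[set G in slices | #|roots q t F G| != phi s t]|
    <= #|rootless q t F| + phi s t * 'C(#|T|, k - t).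
Proof.
have leF : #|F| <= #|rootless q t F| + \sum_(G in slices) #|roots q t F G|.
  rewrite -(cardsID (rootless q t F) F) leq_add ?subset_leq_card ?subsetIr //.
  apply: card_by_roots => A; rewrite inE => /andP [nA AF].
  have [S [G [-> cG SG]]] := rooted_split AF nA; exists S, G; split=> //.
  by rewrite inE cG.
apply: leq_trans (leq_add leF (leqnn _)) _; rewrite -addnA leq_add2l.
rewrite -card_draws mulnC -sum_nat_const -/slices.
have -> : #|[set G in slices | #|roots q t F G| != phi s t]| =
    \sum_(G in slices) (#|roots q t F G| != phi s t).
  rewrite -sum1_card [RHS]big_mkcond [LHS]big_mkcond /=; apply: eq_bigr => G _.
  by rewrite !inE; case: (#|G| == _) => //=; case: (_ != _).
rewrite -big_split /=; apply: leq_sum => G; rewrite inE => /eqP cG.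
by have := card_roots cG; case: eqVneq => //= [-> | ]; lia.
Qed.

(** A rooted member that contains no set of [TT] has its root outside [TT], so its slice has a
    family of roots different from [TT]. *)
Lemma card_unrooted (TT : {set {set T}}) :
  #|F :\: restr_family F TT| <=
    #|rootless q t F| + phi s t * #|[set G in slices | roots q t F G != TT]|.
Proof.
rewrite -(cardsID (rootless q t F) (F :\: _)).
rewrite leq_add ?subset_leq_card ?subsetIr // mulnC -sum_nat_const.
apply: leq_trans (_ : \sum_(G in [set G in slices | roots q t F G != TT])
                        #|roots q t F G| <= _); last first.
  by apply: leq_sum => G; rewrite !inE => /andP [/eqP cG _]; apply: card_roots.
apply: card_by_roots => A; rewrite inE => /andP [nA]; rewrite inE => /andP [nAT AF].
have [S [G [eA cG SG]]] := rooted_split AF nA; exists S, G; split=> //.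
rewrite !inE cG eqxx /=; apply: contraNneq nAT => eTT.
rewrite inE AF; apply/exists_inP; exists S; first by rewrite -eTT.
by rewrite eA subsetUl.
Qed.

End Roots.

(** * Roots shared by most slices *)

Lemma card_inj_ffuns_image (T : finType) (m : nat) (GG : {set {set T}}) :
  uniform m GG ->
  #|[set y : {ffun 'I_m -> T} | injectiveb y && (y @: setT \in GG)]|
    = m`! * #|GG|.
Proof.
move=> /forall_inP unifGG; rewrite -sum1_card.
rewrite (partition_big (fun y : {ffun 'I_m -> T} => y @: setT) (mem GG)) /=; last first.
  by move=> y; rewrite inE => /andP [].
rewrite mulnC -sum_nat_const; apply: eq_bigr => G GGG; rewrite sum1_card.
have /eqP cG := unifGG G GGG.
rewrite -[RHS](ffactnn m) -[X in X ^_ _]cG -[X in _ ^_ X](card_ord m) -card_inj_ffuns_on.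
apply: eq_card => y; rewrite unfold_in !inE.
apply/andP/andP => [[/andP [injy _] /eqP eqG]|[/ffun_onP yG injy]].
  split=> //; apply/ffun_onP => i; rewrite -eqG; exact: imset_f.
have eqG : y @: setT = G.
  apply/eqP; rewrite eqEcard card_imset; last exact/injectiveP.
  rewrite cardsT card_ord cG leqnn andbT.
  by apply/subsetP => x /imsetP [i _ ->].
by rewrite eqG injy eqxx GGG.
Qed.

Section Hybrid.
Variables (T : finType) (m : nat).
Implicit Types x y : {ffun 'I_m -> T}.

Definition hybrid (i : nat) x y : {ffun 'I_m -> T} :=
  [ffun j : 'I_m => if j < i then y j else x j].

Lemma hybrid0 x y : hybrid 0 x y = x.
Proof. by apply/ffunP => j; rewrite ffunE. Qed.

Lemma hybridT x y : hybrid m x y = y.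
Proof. by apply/ffunP => j; rewrite ffunE ltn_ord. Qed.

Lemma hybridK i x y : hybrid i (hybrid i x y) (hybrid i y x) = x.
Proof. by apply/ffunP => j; rewrite !ffunE; case: ltnP. Qed.

(** Being a bijection on pairs, this map shows that the hybrid of a uniformly random pair is
    uniformly distributed. *)
Lemma hybrid_pairK i :
  involutive (fun p : {ffun 'I_m -> T} * {ffun 'I_m -> T} =>
                (hybrid i p.1 p.2, hybrid i p.2 p.1)).
Proof.
by case=> x y /=; rewrite !hybridK.
Qed.

(** Consecutive hybrids differ at most at coordinate [i]. *)
Lemma card_hybrid_image i x y :
  injective (hybrid i x y) ->
  m.-1 <= #|hybrid i x y @: setT :&: hybrid i.+1 x y @: setT|.
Proof.
move=> inj; pose J := [set j : 'I_m | (j : nat) != i].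
have leJ : m.-1 <= #|J|.
  have := cardsC J; rewrite card_ord => cJ.
  suff : #|~: J| <= 1 by move: cJ; lia.
  apply/card_le1_eqP => a b; rewrite !inE !negbK => /eqP ea /eqP eb.
  by apply: val_inj; rewrite /= ea eb.
apply: leq_trans leJ _; rewrite -(card_imset (mem J) inj); apply: subset_leq_card.
apply/subsetP => z /imsetP [j]; rewrite inE => nji ->; rewrite inE imset_f //=.
apply/imsetP; exists j => //; rewrite !ffunE ltnS [in RHS]leq_eqVlt.
by rewrite (negPf nji).
Qed.

End Hybrid.

(* Any two ordered [m]-sets [x], [y] are joined by the path of hybrids, along
   which [tau] is constant as long as all the hybrids are full; each hybrid of a
   uniformly random pair is uniformly distributed. *)
Lemma majority_value (T : finType) (V : eqType) (m : nat) (tau : {set T} -> V)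
    (full : pred {set T}) :
  m <= #|T| ->
  (forall G G' : {set T}, #|G| = m -> #|G'| = m -> m.-1 <= #|G :&: G'| ->
     full G -> full G' -> tau G = tau G') ->
  exists2 G0 : {set T}, #|G0| = m &
    m`! * #|[set G : {set T} | (#|G| == m) && (tau G != tau G0)]| <=
      m.+1 * (#|T| ^ m - #|T| ^_ m
              + m`! * #|[set G : {set T} | (#|G| == m) && ~~ full G]|).
Proof.
move=> leT tauE; pose X := {ffun 'I_m -> T}.
pose good (x : X) := injectiveb x && full (x @: setT).
pose bad := [set x : X | ~~ good x].
pose B (x : X) := [set y : X | ~~ [forall i : 'I_m.+1, good (hybrid i x y)]].
have cX : #|X| = #|T| ^ m by rewrite card_ffun card_ord.
have X_gt0 : 0 < #|X|.
  rewrite cX expn_gt0; case: m leT {tauE X good bad B cX} => [|m'] leT.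
    by rewrite orbT.
  by rewrite ?orbT // (leq_trans _ leT).
have cbad : #|bad| <= #|T| ^ m - #|T| ^_ m
    + m`! * #|[set G : {set T} | (#|G| == m) && ~~ full G]|.
  rewrite -card_inj_ffuns_image; last first.
    by apply/forall_inP => G; rewrite inE => /andP [].
  have <- : #|[set x : X | ~~ injectiveb x]| = #|T| ^ m - #|T| ^_ m.
    have := cardsC [set x : X | injectiveb x].
    have := card_inj_ffuns 'I_m T; rewrite card_ord => ->; rewrite cX => <-.
    by rewrite addKn; apply: eq_card => x; rewrite !inE.
  apply: leq_trans (leq_card_setU _ _).1; apply: subset_leq_card.
  apply/subsetP => x; rewrite !inE /good; case injx: (injectiveb x) => //= nfull.
  rewrite nfull andbT card_imset ?cardsT ?card_ord //; exact/injectiveP.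
have sumB : \sum_x #|B x| <= #|X| * (m.+1 * #|bad|).
  have -> : \sum_x #|B x| = #|[set p : X * X | p.2 \in B p.1]|.
    under eq_bigr do rewrite -sum1_card.
    rewrite pair_big_dep /= sum1_card; apply: eq_card => p. by rewrite [LHS]unfold_in inE.
  apply: leq_trans (_ : #|\bigcup_(i : 'I_m.+1)
       [set p : X * X | ~~ good (hybrid i p.1 p.2)]| <= _).
    apply: subset_leq_card; apply/subsetP => p; rewrite !inE negb_forall.
    by case/existsP => i ngood; apply/bigcupP; exists i => //; rewrite inE.
  (* The involution [hybrid_pairK] carries this set to the pairs whose first component is bad. *)
  have cardi (i : 'I_m.+1) :
      #|[set p : X * X | ~~ good (hybrid i p.1 p.2)]| = #|bad| * #|X|.
    rewrite -[#|X|]cardsT -cardsX.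
    rewrite -(card_preimset _ (inv_inj (@hybrid_pairK T m i))).
    by apply: eq_card => p; rewrite !inE andbT /= hybridK.
  apply: leq_trans (card_bigcup_leq (c := #|bad| * #|X|) _) _ => [i _|].
    by rewrite cardi.
  by rewrite card_ord [leqRHS]mulnC -mulnA.
have [x leBx] : exists x, #|B x| <= m.+1 * #|bad|.
  apply/existsP; rewrite -[X in is_true X]negbK negb_exists; apply/negP => /forallP gtB.
  move: sumB; rewrite leqNgt => /negP; apply.
  rewrite -sum_nat_const; apply: (@leq_trans (\sum_(x : X) (m.+1 * #|bad|).+1)).
    by rewrite !sum_nat_const ltn_pmul2l.
  by apply: leq_sum => x _; rewrite ltnNge gtB.
have cgood z : good z -> #|z @: setT| = m.
  by case/andP => /injectiveP injz _; rewrite card_imset // cardsT card_ord.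
(* If [x] is not good, hybrid 0 fails for every [y], so [B x] is everything and any [m]-set serves
   as [G0]. *)
have [G0 cG0 G0x] : exists2 G0 : {set T}, #|G0| = m & good x -> G0 = x @: setT.
  case: (boolP (good x)) => gx; first by exists (x @: setT) => //; apply: cgood.
  have [|G0 _ cG0] := @exists_subset_card _ [set: T] m; first by rewrite cardsT.
  by exists G0.
exists G0 => //; rewrite -card_inj_ffuns_image; last first.
  by apply/forall_inP => G; rewrite inE => /andP [].
apply: leq_trans (leq_trans leBx _); last by rewrite leq_mul2l cbad orbT.
apply: subset_leq_card; apply/subsetP => y; rewrite !inE => /and3P [injy _].
apply: contraNN => /forallP goodh.
have goodi i : i <= m -> good (hybrid i x y).
  by move=> lei; have := goodh (inord i); rewrite inordK.
have chain i : i <= m -> tau (hybrid i x y @: setT) = tau (x @: setT).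
  elim: i => [|i IHi] lei; first by rewrite hybrid0.
  rewrite -IHi ?(ltnW lei) //; have gi := goodi i (ltnW lei); have gi1 := goodi _ lei.
  apply: tauE; rewrite ?cgood //.
  - by rewrite setIC card_hybrid_image //; apply/injectiveP; case/andP: gi.
  - by case/andP: gi1.
  - by case/andP: gi.
have := chain m (leqnn m); rewrite hybridT => ->.
by rewrite G0x //; have := goodi 0 (leq0n m); rewrite hybrid0.
Qed.

(** * Estimates *)

Lemma leq_expn_base (a b m : nat) : a <= b -> a ^ m <= b ^ m.
Proof. by case: m => // m leab; rewrite leq_exp2r. Qed.

(** Bernoulli's inequality for [1 - a / n], multiplied by [n ^ m]. For [m = 0] the truncated
    exponent is harmless, since the factor [m] vanishes. *)
Lemma leq_exp_bernoulli (n a m : nat) :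
  n ^ m <= (n - a) ^ m + m * a * n ^ m.-1.
Proof.
elim: m => [|m IHm]; first by rewrite !expn0 leq_addr.
have leP : (n - a) ^ m <= n ^ m by rewrite leq_expn_base ?leq_subr.
have le1 : n * (n - a) ^ m <= (n - a) ^ m.+1 + a * n ^ m.
  apply: leq_trans (_ : (n - a + a) * (n - a) ^ m <= _).
    by rewrite leq_mul2r; apply/orP; right; lia.
  by rewrite mulnDl expnS leq_add2l leq_mul2l leP orbT.
have le2 : n * (m * a * n ^ m.-1) <= m * a * n ^ m.
  by case: m {IHm leP le1} => [|m]; rewrite ?mul0n ?muln0 // mulnCA expnS.
rewrite expnS; apply: leq_trans (leq_mul (leqnn n) IHm) _.
rewrite mulnDr; apply: leq_trans (leq_add le1 le2) _.
by rewrite -addnA leq_add2l -mulnDl mulSn.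
Qed.

Lemma leq_exp_ffact (n m : nat) : (n - m) ^ m <= n ^_ m.
Proof.
elim: m n => [|m IHm] n; first by rewrite expn0 ffactn0.
rewrite ffactnS expnS leq_mul ?leq_subr //.
by apply: leq_trans (IHm n.-1); rewrite -subn1 -subnDA add1n.
Qed.

Lemma leq_ffact_exp (n m : nat) : n ^_ m <= n ^ m.
Proof.
elim: m n => [|m IHm] n; first by rewrite expn0 ffactn0.
by rewrite ffactnS expnS leq_mul // (leq_trans (IHm _)) // leq_expn_base // leq_pred.
Qed.

(** The lower bound on [n] keeps the loss in [leq_exp_bernoulli] below half of [n ^ (k - t)]. *)
Lemma exp_leq_bin (k t n : nat) : 0 < t -> t < k -> 2 * k ^ 2 + 1 <= n ->
  n ^ (k - t) <= 2 * ((n - t) ^_ (k - t)).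
Proof.
move=> t_gt0 ltk len; have := leq_exp_bernoulli n k (k - t).
have -> : n ^ (k - t) = n * n ^ (k - t).-1 by rewrite -expnS prednK ?subn_gt0.
have := leq_exp_ffact (n - t) (k - t).
rewrite (_ : n - t - (k - t) = n - k); last by lia.
set X := n ^ _; set Y := (n - k) ^ _; set Z := _ ^_ _ => leYZ leX.
have leK : (k - t) * k * X * 2 <= n * X.
  rewrite mulnAC leq_mul2r; apply/orP; right; nia.
lia.
Qed.

Local Open Scope ring_scope.

(** In the application [m = k - t], [f = #|F|], [p = phi s t], [c = 'C(n, m)] and
    [q = 'C(n - t, m)]. Moreover [rho] counts rootless members, [N] slices that are not full, [g]
    slices whose roots differ from the chosen family, and [L] members that contain no set of that
    family. The bounds are obtained for [N], then [g], then [L]. *)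
Lemma stability_arith (R : realType) (k m n f N rho g L p C1 c q : nat) (delta : R) :
  (0 < n)%N -> (0 < p)%N -> (0 < m)%N -> (m < k)%N -> 0 < delta ->
  (f + N <= rho + p * c)%N -> (L <= rho + p * g)%N ->
  (m`! * g <= m.+1 * (n ^ m - n ^_ m + m`! * N))%N ->
  (rho <= C1 * n ^ m.-1)%N -> (c <= 3 * q)%N -> (n ^ m <= 2 * (q * m`!))%N ->
  (1 - delta) * p%:R * c%:R <= f%:R ->
  L%:R <= (3 * k%:R * p%:R ^+ 2 * delta
           + ((C1 + k * (k ^ 2 + C1)) * (2 * k`!))%:R / n%:R) * p%:R * q%:R.
Proof.
move=> n0 p0 m0 ltmk d0 leF leL leg lerho lec leq_ led.
set X := (n ^ m.-1)%N in lerho.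
have eX : (n ^ m = n * X)%N by rewrite /X -expnS prednK.
have leff : (n ^ m - n ^_ m <= m ^ 2 * X)%N.
  have := leq_exp_ffact n m; have := leq_exp_bernoulli n m m.
  by rewrite -/X mulnn; lia.
have leg' : (g <= k * (k ^ 2 * X + N))%N.
  have mf0 := fact_gt0 m.
  apply: (@leq_trans (m.+1 * (m ^ 2 * X + N))).
    rewrite -(leq_pmul2l mf0); apply: leq_trans leg _.
    rewrite mulnCA leq_mul2l /= mulnDr leq_add2r.
    by apply: leq_trans leff _; rewrite leq_pmull.
  by rewrite leq_mul // leq_add2r leq_mul2r leq_expn_base ?orbT // ltnW.
(* This makes every term in [X] of order [q / n], the source of the summand with [n] in the
   denominator. *)
have leXq : (n * X <= 2 * k`! * q)%N.
  rewrite -eX; apply: leq_trans leq_ _.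
  by rewrite -mulnA leq_mul2l /= mulnC leq_mul2r leq_fact ?orbT // ltnW.
have nR : 0 < n%:R :> R by rewrite ltr0n.
have pR : 1 <= p%:R :> R by rewrite ler1n.
have NR : N%:R <= C1%:R * X%:R + delta * p%:R * c%:R :> R.
  have : (f + N)%:R <= (C1 * X + p * c)%:R :> R.
    by rewrite ler_nat; apply: leq_trans leF _; rewrite leq_add2r.
  by rewrite !natrD !natrM; move: led; lra.
have XR : X%:R <= (2 * k`!)%:R * q%:R / n%:R :> R.
  by rewrite ler_pdivlMr // -!natrM ler_nat mulnC.
have cR : c%:R <= 3 * q%:R :> R by rewrite -natrM ler_nat.
have LR : L%:R <= C1%:R * X%:R + p%:R * (k%:R * (k%:R ^+ 2 * X%:R + N%:R)) :> R.
  rewrite -natrX -!(natrM, natrD) ler_nat; apply: leq_trans leL _.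
  by rewrite leq_add // leq_mul2l leg' orbT.
apply: le_trans LR _.
set D := (2 * k`!)%:R in XR *.
have -> : (((C1 + k * (k ^ 2 + C1)) * (2 * k`!))%:R
    = (C1%:R + k%:R * (k%:R ^+ 2 + C1%:R)) * D :> R)
  by rewrite natrM natrD natrM natrD natrX.
have kR : 0 <= k%:R :> R by [].
have CR : 0 <= C1%:R :> R by [].
have X0 : 0 <= X%:R :> R by [].
have q0 : 0 <= q%:R :> R by [].
have c0 : 0 <= c%:R :> R by [].
set y := X%:R in NR XR X0 *; set kk := k%:R in kR *; set P := p%:R in pR NR *.
set CC := C1%:R in NR CR *; set Q := q%:R in XR cR q0 *; set cc := c%:R in NR cR c0.
have P0 : 0 <= P by lra.
apply: (@le_trans _ _ (P * (CC + kk * (kk ^+ 2 + CC)) * y + kk * P ^+ 2 * delta * cc)).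
  have h1 : CC * y <= P * (CC * y) by rewrite ler_peMl ?mulr_ge0.
  have h2 : P * (kk * (kk ^+ 2 * y + N%:R))
     <= P * (kk * (kk ^+ 2 * y + (CC * y + delta * P * cc))).
    by rewrite !ler_wpM2l // lerD2l.
  apply: le_trans (lerD h1 h2) _.
  by rewrite le_eqVlt; apply/orP; left; apply/eqP; ring.
(* The first summand is compared through [XR], the second through [cc <= 3 * Q <= P * (3 * Q)]. *)
have -> : (3 * kk * P ^+ 2 * delta + (CC + kk * (kk ^+ 2 + CC)) * D / n%:R) * P * Q
  = P * (CC + kk * (kk ^+ 2 + CC)) * (D * Q / n%:R)
    + kk * P ^+ 2 * delta * (P * (3 * Q)).
  by field; rewrite gt_eqF.
apply: lerD.
  by rewrite ler_wpM2l // mulr_ge0 // addr_ge0 // mulr_ge0 // addr_ge0 // exprn_ge0.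
rewrite ler_wpM2l //.
  by rewrite !mulr_ge0 ?exprn_ge0 // ltW.
by apply: le_trans cR _; rewrite ler_peMl // mulr_ge0.
Qed.

(** * Stability of almost extremal families *)

Theorem theorem1p3 (R : realType) (s k : nat) (hs : (2 <= s)%N) :
  exists (C : R) (n0 : nat),
  forall (t : nat) (ht : (1 <= t)%N) (hkt : (2 * t + 1 <= k)%N)
         (n : nat) (hn : (n0 <= n)%N) (delta : R) (hdelta : 0 < delta)
         (F : {set {set 'I_n}}) (hFk : uniform k F)
         (hF : sunflower_core_free s (t - 1) F)
         (hFcard : (1 - delta) * (phi s t)%:R * ('C(n, k - t))%:R
                     <= (#|F|)%:R :> R),
  exists TT : {set {set 'I_n}},
    [/\ uniform t TT,
        sunflower_free s TT &
        (#|F :\: restr_family F TT|)%:R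
          <= (3 * k%:R * (phi s t)%:R ^+ 2 * delta + C / n%:R)
             * (phi s t)%:R * ('C(n - t, k - t))%:R :> R].
Proof.
pose q := (2 * s * k)%N; pose C1 := ((2 ^ k * (k * q) + 1) ^ (2 ^ k))%N.
(* The constant comes from [stability_arith] and the threshold from [exp_leq_bin]; neither involves
   [t]. *)
exists ((C1 + k * (k ^ 2 + C1)) * (2 * k`!))%:R, (2 * k ^ 2 + 1)%N.
move=> t t_gt0 lek n len delta d_gt0 F unifF freeF leF.
have lekn : (k <= n)%N by nia.
pose m := (k - t)%N.
(* Taking [B] itself [s] times in [kernel_sunflower] gives a sunflower of [F] with core [B]. *)
have nker (B : {set 'I_n}) : #|B| = (t - 1)%N -> ~~ kernel q F B.
  move=> cB; apply/negP => kerB.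
  have capB i j : i != j -> (fun _ : 'I_s => B) i :&: (fun _ => B) j = B.
    by move=> _; rewrite setIid.
  have ltB : (#|B| < k)%N by rewrite cB; lia.
  have := kernel_sunflower hs unifF (fun _ => kerB) capB ltB.
  by rewrite cB freeF.
have lerho : (#|rootless q t F| <= C1 * n ^ m.-1)%N.
  by have := card_rootless unifF t_gt0 lek nker; rewrite card_ord subn1.
have [||G0 cG0 leg] := @majority_value 'I_n _ m (roots q t F)
  (fun G => #|roots q t F G| == phi s t).
- by rewrite card_ord /m; lia.
- move=> G G' cG cG' leG /eqP fG /eqP fG'.
  by apply: (eq_full_roots hs t_gt0 lek unifF freeF) => //; rewrite /m in leG; lia.
(* The family is that of the majority slice [G0]; it is sunflower-free by the two-slice lemma with
   both slices equal to [G0]. *)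
exists (roots q t F G0); split; first exact: roots_uniform.
  rewrite -[roots _ _ _ _]setUid; apply: sunflower_free_roots => //; first by lia.
  by rewrite setIid cG0 /m; lia.
have leL := card_unrooted hs t_gt0 lek unifF freeF (roots q t F G0).
have leN := card_nonfull hs t_gt0 lek unifF freeF.
rewrite !card_ord in leg leN.
have slice (P : pred {set 'I_n}) :
    [set G in [set G : {set 'I_n} | #|G| == m] | P G]
    = [set G : {set 'I_n} | (#|G| == m) && P G].
  by apply/setP => G; rewrite !inE.
rewrite -/m !slice in leL leN.
have lef := @exp_leq_bin k t n t_gt0 _ len.
have {lef} lef : (n ^ m <= 2 * ('C(n - t, m) * m`!))%N.
  by rewrite bin_ffact; apply: lef; lia.
apply: (stability_arith _ _ _ _ _ leN leL leg lerho _ lef leF) => //; first by lia.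
- by apply: phi_gt0.
- by rewrite /m; lia.
- by rewrite /m; lia.
have := leq_ffact_exp n m; rewrite -bin_ffact => lec.
rewrite -(leq_pmul2r (fact_gt0 m)) -mulnA.
by apply: leq_trans lec (leq_trans lef _); rewrite leq_mul2r orbT.
Qed.
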